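(* Assume the following statement (Cherlin Theorem I): if $R$ is a commutative associative nilring such that the componentwise action of $\mathrm{Aut}(R)$ on $R\times R\times R$ has only finitely many orbits, then $R$ is nilpotent; in particular every $\omega$-categorical commutative nilring is nilpotent. Then: (1) For every prime $p$, every $\omega$-categorical associative nilalgebra $A$ over $\mathbb{F}_p$ whose adjoint group $A^\circ$ is nilpotent is nilpotent as an associative algebra. (2) In particular, if moreover the statement WCG holds (for all primes $p$ and all integers $n\geq 1$, every $\omega$-categorical $n$-Engel $p$-group is nilpotent), then every $\omega$-categorical associative nilring is nilpotent.
   Context: A structure $M$ is $\omega$-categorical if its first-order theory has a unique countable model up to isomorphism (finite structures are allowed); by the Ryll-Nardzewski theorem, for countable $M$ this is equivalent to: for every $n\in\mathbb{N}$ the componentwise action of $\mathrm{Aut}(M)$ on $M^n$ has only finitely many orbits, and the latter may be taken as the definition. Rings and algebras are viewed as structures with $+$ and multiplication; groups with their multiplication. Rings and associative algebras are not assumed unital. A ring or associative algebra is a nilring, resp. nilalgebra, if for each element $x$ there is $k$ with $x^k=0$. It is nilpotent if there is $k$ such that every product of $k$ elements is $0$. The adjoint group $A^\circ$ of a nilalgebra $A$ is the set $A$ with the group operation $x\circ y=x+y+xy$ (identity $0$, inverse of $a$ equal to $\sum_{i\geq 1}(-a)^i$). A group is $n$-Engel if $[x,y,\ldots,y]=1$ ($y$ repeated $n$ times) for all $x,y$, where $[g,h]=g^{-1}h^{-1}gh$ and commutators are left-normed: $[x,y,z]=[[x,y],z]$. A $p$-group is a group in which every element has order a power of $p$. *)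

(* Defs.v *)
From HB Require Import structures.
From mathcomp Require Import all_boot all_order all_algebra.
From mathcomp Require Import classical_sets cardinality.

Set Implicit Arguments.
Unset Strict Implicit.
Unset Printing Implicit Defensive.

Import GRing.Theory.
Local Open Scope classical_set_scope.
Local Open Scope ring_scope.

Declare Scope rng_scope.
Delimit Scope rng_scope with rng.
Local Open Scope rng_scope.
Reserved Notation "x ** y" (at level 40, left associativity).
Reserved Notation "x ^** n" (at level 29, left associativity).

(* Associative rings without unit: MathComp's ring structures are all unital. *)
HB.mixin Record Zmodule_isRng R of GRing.Zmodule R := {
  rmul : R -> R -> R;
  rmulA : associative rmul;
  rmulDl : left_distributive rmul +%R;
  rmulDr : right_distributive rmul +%R
}.

#[short(type="rngType")]
HB.structure Definition Rng := {R of Zmodule_isRng R & GRing.Zmodule R}.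

Notation "x ** y" := (rmul x y) : rng_scope.

(* x ^** n is the product of n copies of x for n >= 1; x ^** 0 = 0 is a junk
   value, there being no unit. *)
Definition rpow (R : rngType) (x : R) (n : nat) : R :=
  iterop n (@rmul R) x 0.
Arguments rpow : simpl never.

Notation "x ^** n" := (rpow x n) : rng_scope.

HB.mixin Record Rng_isNil R of Rng R := {
  rng_nil : forall x : R, exists2 k : nat, (0 < k)%N & x ^** k = 0
}.

#[short(type="nilRngType")]
HB.structure Definition NilRng := {R of Rng_isNil R & Rng R}.

HB.mixin Record Lmodule_isRngAlg (K : comNzRingType) A
    of GRing.Lmodule K A & Rng A := {
  rscaleAl : forall (c : K) (x y : A), c *: (x ** y) = (c *: x) ** y;
  rscaleAr : forall (c : K) (x y : A), c *: (x ** y) = x ** (c *: y)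
}.

#[short(type="nilRngAlgType")]
HB.structure Definition NilRngAlg (K : comNzRingType) :=
  {A of GRing.Lmodule K A & NilRng A & Lmodule_isRngAlg K A}.

(* The product is foldl over a nonempty list, hence the bound 0 < k. *)
Definition nilpotent_rng (R : rngType) : Prop :=
  exists2 k : nat, (0 < k)%N &
    forall (x : R) (s : seq R), size (x :: s) = k -> foldl rmul x s = 0.

Section Oligomorphic.
Variables (T : Type) (Aut : set (T -> T)).

Definition tuple_orbit n (t : n.-tuple T) : set (n.-tuple T) :=
  [set map_tuple f t | f in Aut].

Definition finitely_many_orbits (n : nat) : Prop :=
  finite_set (range (@tuple_orbit n)).

(* By Ryll-Nardzewski, this is omega-categoricity of a countable (possibly
   finite) structure on T whose automorphism group is Aut. *)
Definition omega_categorical : Prop :=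
  countable [set: T] /\ forall n, finitely_many_orbits n.

End Oligomorphic.

(* Algebras are structures for + and multiplication only, so this is also the
   automorphism group used for them. *)
Definition rng_aut (R : rngType) : set (R -> R) :=
  [set f | [/\ bijective f, {morph f : x y / x + y}
             & {morph f : x y / x ** y}]].

Definition group_aut (G : groupType) : set (G -> G) :=
  [set f | bijective f /\ {morph f : x y / (x * y)%g}].

Section Groups.
Variable G : groupType.
Local Open Scope group_scope.

Definition is_subgroup (H : set G) : Prop :=
  [/\ H 1, forall x y, H x -> H y -> H (x * y) & forall x, H x -> H x^-1].

Fixpoint lower_central (n : nat) : set G :=
  if n is m.+1 then
    smallest is_subgroup
      [set [~ x, y] | x in lower_central m & y in [set: G]]
  else [set: G].

Definition nilpotent_group : Prop :=
  exists n, lower_central n = [set 1].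

Definition engel (n : nat) : Prop :=
  forall x y : G, iter n (fun z => [~ z, y]) x = 1.

Definition has_order (x : G) (m : nat) : Prop :=
  [/\ (0 < m)%N, x ^+ m = 1 & forall j, (0 < j < m)%N -> x ^+ j <> 1].

Definition p_group (p : nat) : Prop :=
  forall x : G, exists k : nat, has_order x (p ^ k)%N.

End Groups.

Section Adjoint.
Variable A : nilRngType.
Implicit Types x y a : A.

Definition adj_mul x y : A := x + y + x ** y.

(* ex_minn needs a boolean predicate, provided by the decidable equality of A. *)
Lemma nil_bounded a : exists k : nat, (0 < k)%N && (a ^** k == 0).
Proof. by case: (rng_nil a) => k k0 /eqP ak; exists k; rewrite k0. Qed.

Definition nil_index a : nat := ex_minn (nil_bounded a).

(* The series stops at the nilpotency index of - a. *)
Definition adj_inv a : A :=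
  \sum_(1 <= i < nil_index (- a)) (- a) ^** i.

Lemma rmul0r a : 0 ** a = 0.
Proof. by apply: (addrI (0 ** a)); rewrite -rmulDl !addr0. Qed.

Lemma rmulr0 a : a ** 0 = 0.
Proof. by apply: (addrI (a ** 0)); rewrite -rmulDr !addr0. Qed.

Lemma rmulNr a x : (- a) ** x = - (a ** x).
Proof. by apply: (addrI (a ** x)); rewrite -rmulDl !subrr rmul0r. Qed.

Lemma rmulrN a x : x ** (- a) = - (x ** a).
Proof. by apply: (addrI (x ** a)); rewrite -rmulDr !subrr rmulr0. Qed.

Lemma rpowS a n : (0 < n)%N -> a ^** n.+1 = a ** a ^** n.
Proof. by case: n. Qed.

Lemma rpowSr a n : (0 < n)%N -> a ^** n.+1 = a ^** n ** a.
Proof.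
elim: n => // [[|n] IHn] _ //.
by rewrite rpowS // [in LHS]IHn // rmulA -rpowS.
Qed.

Lemma adj_mulA : associative adj_mul.
Proof.
move=> x y z; rewrite /adj_mul !rmulDl !rmulDr rmulA.
by rewrite !addrA [LHS](ACl (1*2*5*3*6*4*7)%AC).
Qed.

Lemma adj_mul0a : left_id 0 adj_mul.
Proof. by move=> x; rewrite /adj_mul rmul0r addr0 add0r. Qed.

Lemma adj_mula0 : right_id 0 adj_mul.
Proof. by move=> x; rewrite /adj_mul rmulr0 !addr0. Qed.

Lemma adj_inv_shift a :
  \sum_(1 <= i < nil_index (- a)) (- a) ^** i.+1 = adj_inv a + a.
Proof.
rewrite /adj_inv /nil_index; case: ex_minnP => -[//|k] /andP[_ /eqP ak] _.
case: k ak => [|k] ak.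
  by rewrite !big_geq // -[a in RHS]opprK [- a]ak oppr0 addr0.
rewrite big_nat_recr // ak /= addr0 [in RHS]big_ltn // [in RHS]big_add1.
by rewrite [RHS]addrAC addNr add0r.
Qed.

Lemma adj_mulVa : left_inverse 0 adj_inv adj_mul.
Proof.
move=> a; rewrite /adj_mul -adj_inv_shift /adj_inv.
rewrite (big_morph (fun x => x ** a)
  (fun x y => rmulDl x y a) (rmul0r a)) -big_split /=.
rewrite big1_seq // => i /andP[_]; rewrite mem_index_iota => /andP[i0 _].
by rewrite rpowSr // rmulrN addNr.
Qed.

Lemma adj_mulaV : right_inverse 0 adj_inv adj_mul.
Proof.
move=> a; rewrite /adj_mul [a + _]addrC -adj_inv_shift /adj_inv.
rewrite (big_morph (rmul a) (rmulDr a) (rmulr0 a)) -big_split /=.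
rewrite big1_seq // => i /andP[_]; rewrite mem_index_iota => /andP[i0 _].
by rewrite rpowS // rmulNr addNr.
Qed.

End Adjoint.

Definition adjoint (A : nilRngType) : Type := A.

HB.instance Definition _ (A : nilRngType) := Choice.on (adjoint A).
HB.instance Definition _ (A : nilRngType) :=
  isGroup.Build (adjoint A) (@adj_mulA A) (@adj_mul0a A) (@adj_mula0 A)
    (@adj_mulVa A) (@adj_mulaV A).

Definition Cherlin_theorem_I : Prop :=
  forall R : nilRngType, commutative (@rmul R) ->
    finitely_many_orbits (@rng_aut R) 3 -> nilpotent_rng R.

Definition WCG : Prop :=
  forall (p n : nat) (G : groupType), prime p -> (1 <= n)%N ->
    omega_categorical (@group_aut G) -> engel G n -> p_group G p ->
    nilpotent_group G.

(* Main.v *)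
(* Commuting in the adjoint group is commuting in the ring, so the center Z of
   A is also that of its adjoint group. As Z is a commutative ring with
   finitely many orbits of triples, it is nilpotent, and then so is an ideal
   containing it; modulo that ideal the class of the adjoint group drops,
   which gives the first part by induction. For the second part, R has
   exponent N, and it suffices that some power of R lies in pR for each
   prime p dividing N, as products of such powers then lie in NR = 0. So let
   pR = 0. In a long word in x and y two prefixes lie in the same orbit over
   (x, y), hence are equal, say u = uv, and v is nilpotent, so u = 0. Thus
   two-generated subrings of R are nilpotent of bounded class, the adjoint
   group of R is an n-Engel p-group, and WCG reduces to the first part. *)
Require Import Defs.
From HB Require Import structures.
From mathcomp Require Import all_boot all_order all_algebra.
From mathcomp Require Import boolp classical_sets functions cardinality.

Set Implicit Arguments.
Unset Strict Implicit.
Unset Printing Implicit Defensive.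

Import GRing.Theory.
Local Open Scope classical_set_scope.
Local Open Scope ring_scope.
Local Open Scope rng_scope.

(** * Finitely many orbits, and their transfer between structures *)

(** Orbits become [K] colours such that tuples of equal colour are related by [Aut], the form suited
    to pigeonhole arguments. *)
Lemma finitely_many_orbits_classify (T : Type) (Aut : set (T -> T)) n :
    Aut id -> finitely_many_orbits Aut n ->
  exists (c : n.-tuple T -> nat) K, (forall t, (c t < K)%N) /\
    forall s t, c s = c t -> exists2 f, Aut f & t = map_tuple f s.
Proof.
move=> Aid [K /card_set_bijP[F [Fsub Finj _]]].
exists (fun t => F (tuple_orbit Aut t)), K.
split=> [t|s t /Finj e]; first by apply: Fsub; exists t.
have : tuple_orbit Aut t t by exists id => //; apply/val_inj/map_id.
rewrite -e ?inE; [|by exists s|by exists t].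
by move=> [f Af <-]; exists f.
Qed.

(** Here [h] will be an inclusion, a choice of representatives or the identity. The colour of the
    image of a tuple under [h] determines its orbit. *)
Lemma finitely_many_orbits_transfer (T T' : Type) (Aut : set (T -> T))
    (Aut' : set (T' -> T')) (h : T' -> T) n :
    Aut id ->
    (forall f g, Aut' f -> Aut' g -> Aut' (f \o g)) ->
    (forall f, Aut f -> exists2 f', Aut' f' &
       forall x y, h y = f (h x) -> y = f' x) ->
  finitely_many_orbits Aut n -> finitely_many_orbits Aut' n.
Proof.
move=> Aid Acomp Alift /(finitely_many_orbits_classify Aid)[c [K [cK cP]]].
pose d (t : n.-tuple T') := c (map_tuple h t).
have sub s t : d s = d t -> tuple_orbit Aut' t `<=` tuple_orbit Aut' s.
  move=> /cP[f Af est] u [g Ag <-].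
  have [f' Af' f'P] := Alift _ Af; exists (g \o f'); first exact: Acomp.
  apply: eq_from_tnth => i; rewrite !tnth_map /=; congr g; apply/esym/f'P.
  by have := congr1 (fun w : n.-tuple T => tnth w i) est; rewrite !tnth_map.
(* By [sub], [g i] is a single orbit whenever the colour [i] is attained, so there are at most [K]
   orbits. *)
pose g i := [set u | exists t, d t = i /\ tuple_orbit Aut' t u].
apply: (@sub_finite_set _ _ (g @` `I_K)); last exact: finite_image.
move=> _ [t _ <-]; exists (d t); first exact: cK.
rewrite eqEsubset; split=> [u [s [est]]|u tu]; last by exists t.
exact: sub.
Qed.

(** * Ring automorphisms and pigeonhole on orbits of triples *)

Section Automorphisms.
Variable R : nilRngType.
Implicit Types f g : R -> R.

Lemma rng_aut_id : rng_aut (@id R).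
Proof. by split=> //; exists id. Qed.

Lemma rng_aut_comp f g : rng_aut f -> rng_aut g -> rng_aut (f \o g).
Proof.
move=> [bf fD fM] [bg gD gM]; split; first exact: bij_comp.
- by move=> x y /=; rewrite gD fD.
- by move=> x y /=; rewrite gM fM.
Qed.

Lemma rng_aut_inv f : rng_aut f ->
  exists g, [/\ rng_aut g, cancel f g & cancel g f].
Proof.
move=> [[g fK gK] fD fM]; exists g; split=> //; split; first by exists f.
- by move=> x y; rewrite -{1}(gK x) -{1}(gK y) -fD fK.
- by move=> x y; rewrite -{1}(gK x) -{1}(gK y) -fM fK.
Qed.

Lemma rng_aut0 f : rng_aut f -> f 0 = 0.
Proof. by move=> [_ fD _]; apply: (addrI (f 0)); rewrite -fD !addr0. Qed.

Lemma rng_autMn f x n : rng_aut f -> f (x *+ n) = f x *+ n.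
Proof.
move=> fA; elim: n => [|n IHn]; first by rewrite !mulr0n rng_aut0.
by rewrite !mulrS -IHn; case: fA => _ ->.
Qed.

Lemma rng_aut_foldl f x s : rng_aut f ->
  f (foldl rmul x s) = foldl rmul (f x) (map f s).
Proof. by move=> [_ _ fM]; elim: s x => //= y s IHs x; rewrite IHs fM. Qed.

(** Two of the [K + 1] triples [(x, y, u i)] share an orbit; the automorphism relating them fixes
    [x] and [y], hence every [u i]. The bound [K] is uniform in [x], [y] and [u]. *)
Lemma eventually_repeats : finitely_many_orbits (@rng_aut R) 3 ->
  exists K, forall (x y : R) (u : nat -> R),
    (forall f, rng_aut f -> f x = x -> f y = y -> forall i, f (u i) = u i) ->
  exists i j, [/\ (i < j)%N, (j <= K)%N & u i = u j].
Proof.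
move=> /(finitely_many_orbits_classify rng_aut_id)[c [K [cK cP]]].
exists K => x y u fixu.
pose d (i : 'I_K.+1) : 'I_K := Ordinal (cK [tuple x; y; u i]).
have /injectivePn[i [j nij /(congr1 val) /= /cP[f fA e]]] : ~~ injectiveb d.
  apply/negP => /injectiveP/leq_card; rewrite !card_ord ltnn; exact/negP.
have /= [e0 e1 e2] := congr1 val e.
have {e0 e1}e3 := fixu f fA (esym e0) (esym e1).
wlog ltij : i j nij e e2 / (i < j)%N => [th|].
  case: (ltngtP i j) => [ij|ji|/val_inj/eqP]; last by rewrite (negPf nij).
    exact: (th i j).
  by exists j, i; split=> //; [rewrite -ltnS | rewrite e2 e3].
by exists i, j; split=> //; [rewrite -ltnS | rewrite e2 e3].
Qed.

End Automorphisms.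

(** * Products of several factors *)

Section Products.
Variable R : nilRngType.
Implicit Types (x y : R) (s t : seq R) (P Q : R -> Prop).

Definition products_in P k := forall x s, size (x :: s) = k ->
  P (foldl rmul x s).

Lemma foldl_rmulA x y s : foldl rmul (x ** y) s = x ** foldl rmul y s.
Proof. by elim: s y => //= z s IHs y; rewrite -rmulA IHs. Qed.

Lemma foldl_rmul_cat x s y t :
  foldl rmul x (s ++ y :: t) = foldl rmul x s ** foldl rmul y t.
Proof. by rewrite foldl_cat /= foldl_rmulA. Qed.

Lemma foldl_rmul0 s : foldl rmul (0 : R) s = 0.
Proof. by elim: s => //= x s; rewrite rmul0r. Qed.

Lemma foldl_rmulB x y s :
  foldl rmul (x - y) s = foldl rmul x s - foldl rmul y s.
Proof. by elim: s x y => //= z s IHs x y; rewrite rmulDl rmulNr IHs. Qed.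

(** Cut the word after its first [m] letters. *)
Lemma products_inD P Q (S : R -> Prop) m n : (0 < m)%N -> (0 < n)%N ->
    products_in P m -> products_in Q n ->
    (forall x y, P x -> Q y -> S (x ** y)) ->
  products_in S (m + n).
Proof.
case: m n => [|m] [|n] // _ _ Pm Qn PQ x s [sz].
case def_t: (drop m s) => [|y t].
  by move/(congr1 size): def_t; rewrite size_drop sz addnS subSn ?leq_addr.
move/(congr1 size): (def_t); rewrite size_drop sz addnC addnK => szt.
rewrite -(cat_take_drop m s) def_t foldl_rmul_cat; apply: PQ.
  by apply: Pm; rewrite /= size_take sz addnS ltnS leq_addr.
exact: Qn.
Qed.

(** Iterating the equation gives [x = x ** y ^** j] for all [j > 0], and [y] is nilpotent. *)
Lemma nil_fix_eq0 x y : x = x ** y -> x = 0.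
Proof.
move=> e; have [k k0 yk] := rng_nil y.
suff: forall j, (0 < j)%N -> x = x ** y ^** j.
  by move=> /(_ k k0); rewrite yk rmulr0.
elim=> // -[|j] IHj _ //; rewrite rpowS // rmulA -e; exact: IHj.
Qed.

End Products.

(** * Quotients by two-sided ideals *)

Section Quotient.
Variable A : nilRngType.

Record rng_ideal := RngIdeal {
  ideal_mem :> {pred A};
  ideal_zmod_closed : zmod_closed ideal_mem;
  idealMl : forall a x, x \in ideal_mem -> a ** x \in ideal_mem;
  idealMr : forall a x, x \in ideal_mem -> x ** a \in ideal_mem
}.

HB.instance Definition _ (I : rng_ideal) :=
  GRing.isZmodClosed.Build A (ideal_mem I) (ideal_zmod_closed I).

Variable I : rng_ideal.

Definition rng_quot : Type := Quotient.quot (ideal_mem I).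
HB.instance Definition _ := GRing.Zmodule.on rng_quot.

Definition rng_pi (a : A) : rng_quot :=
  (\pi_(Quotient.quot (ideal_mem I)) a)%qT.
Definition rng_repr (x : rng_quot) : A :=
  repr (x : Quotient.quot (ideal_mem I)).

Lemma rng_reprK : cancel rng_repr rng_pi.
Proof. exact: reprK. Qed.

Lemma rng_piP a b : rng_pi a = rng_pi b <-> a - b \in I.
Proof. by rewrite Quotient.idealrBE; split=> /eqP. Qed.

Lemma rng_piD : {morph rng_pi : x y / x + y}.
Proof. exact: Quotient.pi_add. Qed.

Lemma rng_pi0 : rng_pi 0 = 0.
Proof. by apply: (addrI (rng_pi 0)); rewrite -rng_piD !addr0. Qed.

Lemma rng_pi_eq0 a : rng_pi a = 0 <-> a \in I.
Proof. by rewrite -rng_pi0 rng_piP subr0. Qed.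

Definition quot_mul (x y : rng_quot) := rng_pi (rng_repr x ** rng_repr y).

Lemma quot_mul_pi a b : quot_mul (rng_pi a) (rng_pi b) = rng_pi (a ** b).
Proof.
apply/rng_piP; set a' := rng_repr _; set b' := rng_repr _.
have aI : a' - a \in I by apply/rng_piP; rewrite rng_reprK.
have bI : b' - b \in I by apply/rng_piP; rewrite rng_reprK.
have -> : a' ** b' - a ** b = (a' - a) ** b' + a ** (b' - b).
  by rewrite rmulDl rmulDr rmulNr rmulrN addrA addrNK.
by apply: rpredD; [apply: idealMr | apply: idealMl].
Qed.

Lemma quot_mulA : associative quot_mul.
Proof.
move=> x y z; rewrite -(rng_reprK x) -(rng_reprK y) -(rng_reprK z).
by rewrite !quot_mul_pi rmulA.
Qed.

Lemma quot_mulDl : left_distributive quot_mul +%R.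
Proof.
move=> x y z; rewrite -(rng_reprK x) -(rng_reprK y) -(rng_reprK z).
by rewrite -rng_piD !quot_mul_pi -rng_piD rmulDl.
Qed.

Lemma quot_mulDr : right_distributive quot_mul +%R.
Proof.
move=> x y z; rewrite -(rng_reprK x) -(rng_reprK y) -(rng_reprK z).
by rewrite -rng_piD !quot_mul_pi -rng_piD rmulDr.
Qed.

HB.instance Definition _ :=
  Zmodule_isRng.Build rng_quot quot_mulA quot_mulDl quot_mulDr.

Lemma rng_piM : {morph rng_pi : x y / x ** y}.
Proof. by move=> x y; rewrite -quot_mul_pi. Qed.

Lemma rng_piX a n : rng_pi (a ^** n) = rng_pi a ^** n.
Proof.
case: n => [|n]; first exact: rng_pi0.
elim: n => // n IHn; rewrite rpowS // rng_piM IHn.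
by rewrite /rpow.
Qed.

Lemma quot_nil (x : rng_quot) : exists2 k : nat, (0 < k)%N & x ^** k = 0.
Proof.
have [k k0 ak] := rng_nil (rng_repr x); exists k => //.
by rewrite -(rng_reprK x) -rng_piX ak rng_pi0.
Qed.

HB.instance Definition _ := Rng_isNil.Build rng_quot quot_nil.

Lemma nilpotent_quot : nilpotent_rng rng_quot ->
  exists2 k, (0 < k)%N & products_in [set` I] k.
Proof.
move=> [k k0 kP]; exists k => // x s sz /=; apply/rng_pi_eq0.
have -> : rng_pi (foldl rmul x s) = foldl rmul (rng_pi x) (map rng_pi s).
  by elim: s x {sz} => //= y s IHs x; rewrite IHs rng_piM.
by apply: kP; rewrite /= size_map.
Qed.

Hypothesis I_inv : forall f, rng_aut f -> forall a, a \in I -> f a \in I.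

(** Automorphisms preserve [I], so they descend to the quotient; there the inverse of [f] induces
    the inverse of the map induced by [f]. *)
Lemma quot_orbits n : finitely_many_orbits (@rng_aut A) n ->
  finitely_many_orbits (@rng_aut rng_quot) n.
Proof.
apply: (finitely_many_orbits_transfer (h := rng_repr)).
- exact: rng_aut_id.
- exact: rng_aut_comp.
move=> f fA; pose lift f x := rng_pi (f (rng_repr x)).
have liftE g a : rng_aut g -> lift g (rng_pi a) = rng_pi (g a).
  move=> gA; apply/rng_piP.
  have -> : g (rng_repr (rng_pi a)) - g a = g (rng_repr (rng_pi a) - a).
    by apply: (addIr (g a)); case: gA => _ gD _; rewrite -gD !addrNK.
  by apply: I_inv => //; apply/rng_piP; rewrite rng_reprK.
have [g [gA fK gK]] := rng_aut_inv fA.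
exists (lift f) => [|x y e]; last by rewrite /lift -e rng_reprK.
split.
- by exists (lift g) => x; rewrite -(rng_reprK x) !liftE ?fK ?gK.
- move=> x y; rewrite -(rng_reprK x) -(rng_reprK y) -rng_piD !liftE //.
  by rewrite -rng_piD; case: fA => _ ->.
- move=> x y; rewrite -(rng_reprK x) -(rng_reprK y) -rng_piM !liftE //.
  by rewrite -rng_piM; case: fA => _ _ ->.
Qed.

Lemma quot_omega_categorical : omega_categorical (@rng_aut A) ->
  omega_categorical (@rng_aut rng_quot).
Proof.
move=> [/countable_injP[c c_inj] orb]; split=> [|n]; last exact: quot_orbits.
apply/countable_injP; exists (c \o rng_repr) => x y _ _ /= /c_inj e.
by apply: (can_inj rng_reprK); apply: e; rewrite inE.
Qed.

End Quotient.

(** * The center and the annihilators of its powers *)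

Section Center.
Variable A : nilRngType.

Definition center : {pred A} := fun a => `[< forall b, a ** b = b ** a >].

Lemma centerP a : reflect (forall b, a ** b = b ** a) (a \in center).
Proof. exact: asboolP. Qed.

Lemma center_zmod_closed : zmod_closed center.
Proof.
split=> [|a b /centerP aC /centerP bC]; apply/centerP => c.
  by rewrite rmul0r rmulr0.
by rewrite rmulDl rmulDr rmulNr rmulrN aC bC.
Qed.

HB.instance Definition _ :=
  GRing.isZmodClosed.Build A center center_zmod_closed.

Lemma centerM a b : a \in center -> b \in center -> a ** b \in center.
Proof.
move=> /centerP aC /centerP bC; apply/centerP => c.
by rewrite -rmulA bC aC -rmulA bC rmulA.
Qed.

Lemma center_aut f a : rng_aut f -> a \in center -> f a \in center.
Proof.
move=> fA /centerP aC; have [g [_ _ gK]] := rng_aut_inv fA.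
by apply/centerP => b; rewrite -(gK b); case: fA => _ _ fM; rewrite -!fM aC.
Qed.

(** The center as a nilring in its own right, to which [Cherlin_theorem_I] can be applied. *)
Record center_rng := CenterRng {
  center_val : A;
  centerV : center_val \in center
}.

HB.instance Definition _ := [isSub for center_val].
HB.instance Definition _ := [Choice of center_rng by <:].
HB.instance Definition _ := [SubChoice_isSubZmodule of center_rng by <:].

Definition center_mul (x y : center_rng) :=
  CenterRng (centerM (centerV x) (centerV y)).

Lemma center_mulA : associative center_mul.
Proof. by move=> x y z; apply: val_inj; rewrite /= rmulA. Qed.

Lemma center_mulDl : left_distributive center_mul +%R.
Proof. by move=> x y z; apply: val_inj; rewrite /= rmulDl. Qed.

Lemma center_mulDr : right_distributive center_mul +%R.
Proof. by move=> x y z; apply: val_inj; rewrite /= rmulDr. Qed.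

HB.instance Definition _ :=
  Zmodule_isRng.Build center_rng center_mulA center_mulDl center_mulDr.

Lemma center_nil (x : center_rng) : exists2 k : nat, (0 < k)%N & x ^** k = 0.
Proof.
have [[//|k] _ xk] := rng_nil (center_val x); exists k.+1 => //.
apply: val_inj; rewrite -[RHS]xk; elim: k {xk} => // k IHk.
by rewrite rpowS // -IHk.
Qed.

HB.instance Definition _ := Rng_isNil.Build center_rng center_nil.

(** Automorphisms of [A] and their inverses preserve the center, so they restrict to it. *)
Lemma center_orbits n : finitely_many_orbits (@rng_aut A) n ->
  finitely_many_orbits (@rng_aut center_rng) n.
Proof.
apply: (finitely_many_orbits_transfer (h := center_val)).
- exact: rng_aut_id.
- exact: rng_aut_comp.
move=> f fA; have [g [gA fK gK]] := rng_aut_inv fA.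
pose lift h (hA : rng_aut h) x := CenterRng (center_aut hA (centerV x)).
exists (lift f fA) => [|x y e]; last exact: val_inj.
split.
- exists (lift g gA) => x; apply: val_inj; [exact: fK | exact: gK].
- by move=> x y; apply: val_inj; case: (fA) => _ /= -> _.
- by move=> x y; apply: val_inj; case: (fA) => _ _ /= ->.
Qed.

(* [center_ann j] is the annihilator of the [j]-th power of the center. *)
Definition center_ann j (a : A) :=
  forall s : seq A, all [in center] s -> size s = j -> foldl rmul a s = 0.

Lemma center_annB j a b :
  center_ann j a -> center_ann j b -> center_ann j (a - b).
Proof. by move=> aj bj s sC sz; rewrite foldl_rmulB aj // bj // subr0. Qed.

Lemma center_annMl j a b : center_ann j b -> center_ann j (a ** b).
Proof. by move=> bj s sC sz; rewrite foldl_rmulA bj // rmulr0. Qed.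

Lemma center_ann_aut j f a : rng_aut f -> center_ann j a -> center_ann j (f a).
Proof.
move=> fA aj s sC sz; have [g [gA _ gK]] := rng_aut_inv fA.
have -> : s = map f (map g s).
  by rewrite -map_comp -[LHS]map_id; apply: eq_map => x /=.
rewrite -rng_aut_foldl // aj ?rng_aut0 ?size_map // all_map.
by apply: sub_all sC => x /= xC; apply: center_aut.
Qed.

(* An ideal which contains the center, and is nilpotent when the center is:
   it avoids the additive span needed to define the ideal generated by the
   center. *)
Definition center_ideal_pred : {pred A} :=
  fun a => `[< forall j c, center_ann j.+1 c -> center_ann j (a ** c) >].

Lemma center_idealP a :
  reflect (forall j c, center_ann j.+1 c -> center_ann j (a ** c))
          (a \in center_ideal_pred).
Proof. exact: asboolP. Qed.

Lemma center_ideal_zmod_closed : zmod_closed center_ideal_pred.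
Proof.
split=> [|a b /center_idealP aI /center_idealP bI];
  apply/center_idealP => j c cj.
  by rewrite rmul0r => s _ _; rewrite foldl_rmul0.
by rewrite rmulDl rmulNr; apply: center_annB; [apply: aI | apply: bI].
Qed.

Lemma center_idealMl a x :
  x \in center_ideal_pred -> a ** x \in center_ideal_pred.
Proof.
move=> /center_idealP xI; apply/center_idealP => j c cj.
by rewrite -rmulA; apply/center_annMl/xI.
Qed.

Lemma center_idealMr a x :
  x \in center_ideal_pred -> x ** a \in center_ideal_pred.
Proof.
move=> /center_idealP xI; apply/center_idealP => j c cj.
by rewrite -rmulA; apply/xI/center_annMl.
Qed.

Definition center_ideal :=
  RngIdeal center_ideal_zmod_closed center_idealMl center_idealMr.

(** Commuting [z] past [c] turns the product of [z ** c] with [j] central factors into that of [c]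
    with [j + 1] of them. *)
Lemma center_sub_ideal z : z \in center -> z \in center_ideal.
Proof.
move=> zC; apply/center_idealP => j c cj s sC sz.
by rewrite (centerP _ zC); apply: (cj (z :: s)) => /=; rewrite ?zC ?sz.
Qed.

Lemma center_ideal_aut f : rng_aut f ->
  forall a, a \in center_ideal -> f a \in center_ideal.
Proof.
move=> fA a /center_idealP aI; apply/center_idealP => j c cj.
have [g [gA _ gK]] := rng_aut_inv fA; rewrite -(gK c).
case: (fA) => _ _ <-; apply: center_ann_aut => //; apply: aI.
exact: center_ann_aut.
Qed.

(** If the [k]-th power of the center is 0, all of [A] lies in [center_ann k]. Left multiplication
    by a product of [m] letters, which lies in the ideal, lowers the index by one, and
    [center_ann 0] is 0. *)
Lemma nilpotent_of_quot_center :
  nilpotent_rng center_rng -> nilpotent_rng (rng_quot center_ideal) ->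
  nilpotent_rng A.
Proof.
move=> [k k0 kP] /nilpotent_quot[m m0 mP].
have Ak a : center_ann k a.
  case=> [_ sz|z s /= /andP[zC sC] sz]; first by rewrite -sz in k0.
  suff: foldl rmul z s = 0 by rewrite /= foldl_rmulA => ->; rewrite rmulr0.
  have zsE : all [in center] s -> exists s', s = map center_val s'.
    elim: s {sC sz} => [|y s IHs] /=; first by exists [::].
    by move=> /andP[yC /IHs[s' ->]]; exists (CenterRng yC :: s').
  case: (zsE sC) => s' def_s.
  suff -> : foldl rmul z s = center_val (foldl rmul (CenterRng zC) s').
    by rewrite kP // -sz def_s /= size_map.
  rewrite def_s; set w := CenterRng zC; rewrite -[z]/(center_val w).
  by elim: s' (w) {def_s} => //= y s' IHs w'; rewrite -IHs.
(* The extra letter is the initial element of [center_ann k]; each block of [m] letters put before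
   it lowers the index once. *)
have step j : (j <= k)%N -> products_in (center_ann (k - j)) (m * j).+1.
  elim: j => [_|j IHj ltjk]; first by rewrite subn0 => x s _; apply: Ak.
  rewrite mulnS -addnS; apply: products_inD m0 _ mP (IHj (ltnW ltjk)) _ => //.
  by move=> x y /center_idealP xI yk; apply: xI; rewrite subnSK.
exists (m * k).+1 => // x s sz.
by have := step k (leqnn k) x s sz; rewrite subnn; move=> /(_ [::] isT erefl).
Qed.

End Center.

(** * Lower central series and nilpotent adjoint groups *)

Lemma lower_central_image (G H : groupType) (f : G -> H) n :
    {morph f : x y / (x * y)%g} -> (forall h, exists g, f g = h) ->
  @lower_central H n `<=` f @` @lower_central G n.
Proof.
move=> fM f_surj; have f1 : f 1%g = 1%g.
  by apply: (mulgI (f 1%g)); rewrite -fM !mulg1.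
have fV x : f x^-1%g = (f x)^-1%g.
  by apply: (mulgI (f x)); rewrite -fM !mulgV.
elim: n => [|n IHn] /=; first by move=> h _; have [g <-] := f_surj h; exists g.
(* An intersection of subgroups is a subgroup, so [smallest] really yields one; its image under [f]
   is then a subgroup of [H]. *)
have sub1 (X : set G) : is_subgroup (smallest (@is_subgroup G) X).
  split=> [K [[]]//|x y Xx Xy K KX|x Xx K KX]; case: (KX) => [[_ KM KV] _].
    by apply: KM; [apply: Xx | apply: Xy].
  by apply: KV; apply: Xx.
apply: smallest_sub.
  have [X1 XM XV] :=
    sub1 [set [~ x, y]%g | x in @lower_central G n & y in [set: G]].
  split; first by exists 1%g.
    by move=> _ _ [x xn <-] [y yn <-]; exists (x * y)%g; [apply: XM|].
  by move=> _ [x xn <-]; exists x^-1%g; [apply: XV|].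
move=> _ [_ /IHn[x xn <-]] [h _ <-]; have [y <-] := f_surj h.
exists [~ x, y]%g; first by apply: sub_gen_smallest; exists x => //; exists y.
by rewrite /commg /conjg !fM !fV.
Qed.

Lemma commutator_lower_central (G : groupType) (x y : G) n :
  lower_central n x -> lower_central n.+1 [~ x, y]%g.
Proof. by move=> xn; apply: sub_gen_smallest; exists x => //; exists y. Qed.

(** Induction on the class, with [A] varying. Inclusion in the trivial group is all that has to be
    carried to the quotient. *)
Lemma nilpotent_of_adjoint n (A : nilRngType) :
    Cherlin_theorem_I -> finitely_many_orbits (@rng_aut A) 3 ->
  @lower_central (adjoint A) n `<=` [set 1%g] -> nilpotent_rng A.
Proof.
move=> cherlin; elim: n A => [|n IHn] A orb A1.
  (* Term 0 of the series is the whole group, so [A] is zero. *)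
  by exists 1 => // x s _; rewrite (A1 x I : x = 0) foldl_rmul0.
apply: nilpotent_of_quot_center.
  apply: cherlin (center_orbits orb) => x y.
  by apply: val_inj; apply/(centerP _ (centerV x)).
apply: IHn (quot_orbits (@center_ideal_aut A) orb) _.
pose pi : adjoint A -> adjoint (rng_quot (center_ideal A)) :=
  @rng_pi A (center_ideal A).
have piM : {morph pi : x y / (x * y)%g}.
  move=> x y; rewrite -[RHS]/(adj_mul (rng_pi _ x) (rng_pi _ y)).
  by rewrite -[LHS]/(rng_pi _ (adj_mul x y)) /adj_mul !rng_piD rng_piM.
have pi_surj h : exists g, pi g = h.
  by exists (rng_repr h); apply: rng_reprK.
apply: subset_trans (lower_central_image piM pi_surj) _ => _ [a an <-].
(* The commutator of [a] and [b] lies in term [n + 1], which is trivial; so [a] is central and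
   vanishes in the quotient. *)
apply/rng_pi_eq0/center_sub_ideal/centerP => b.
have /A1/eqP/commgP ab := commutator_lower_central (b : adjoint A) an.
have : adj_mul a b = adj_mul b a := ab.
by rewrite /adj_mul [b + a]addrC => /addrI.
Qed.

(** * Words in two elements, graded by length *)

(* A product of [K + 1] letters has two equal prefixes [u = u ** v], so
   [u = u ** v ^** k = 0]. *)
Lemma long_words_vanish (R : nilRngType) :
    finitely_many_orbits (@rng_aut R) 3 ->
  exists K, forall (x y a : R) s, all (pred2 x y) (a :: s) -> (K <= size s)%N ->
    foldl rmul a s = 0.
Proof.
move=> /eventually_repeats[K KP]; exists K => x y a s xys leKs.
have [f fA fx fy i|i [j [ltij lejK]]] :=
  KP x y (fun i => foldl rmul a (take i s)).
  rewrite rng_aut_foldl //; have fix_xy z : z \in a :: s -> f z = z.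
    by move=> /(allP xys)/pred2P[] ->.
  rewrite fix_xy ?mem_head // map_id_in // => z /mem_take zs.
  by rewrite fix_xy // inE zs orbT.
have ltis : (i < size s)%N by rewrite (leq_trans ltij) ?(leq_trans lejK).
(* As [i < j], the letters between the two prefixes form a nonempty word, the factor [v]. *)
have -> : take j s = take i s ++ nth 0 s i :: take (j - i.+1) (drop i.+1 s).
  rewrite -{1}(cat_take_drop i s) (drop_nth 0) // take_cat size_take ltis.
  by rewrite ltnNge ltnW //= -subnSK.
rewrite foldl_rmul_cat => /nil_fix_eq0 ui.
by rewrite -(cat_take_drop i s) foldl_cat ui foldl_rmul0.
Qed.

(* In terms of [1 + g], [1 + h] and [1 + c], this reads
   [(1 + h) (1 + g) c = g h - h g]. *)
Lemma adj_commgE (R : nilRngType) (g h c : R) :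
    adj_mul (adj_mul h g) c = adj_mul g h ->
  c = (g ** h - h ** g) + adj_inv (adj_mul h g) ** (g ** h - h ** g).
Proof.
set u := adj_mul h g => uc; have <- : c + u ** c = g ** h - h ** g.
  apply: (addrI u); rewrite addrA -[LHS]/(adj_mul u c) uc /u /adj_mul.
  by rewrite [RHS]addrACA subrr addr0 (addrC h).
(* This is [(1 + adj_inv u) (1 + u) = 1], which cancels [1 + u] in front of [c]. *)
have wu : adj_inv u + u + adj_inv u ** u = 0 by apply: adj_mulVa.
rewrite rmulDr rmulA -addrA -!rmulDl addrA (addrC u) wu.
by rewrite rmul0r addr0.
Qed.

Section WordSpan.
Variables (R : nilRngType) (x y : R).

(** The additive span of words with at least [i + 1] letters, that is, the power [i + 1] of the
    subring generated by [x] and [y]. *)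
Inductive word_span (i : nat) : R -> Prop :=
| word_span0 : word_span i 0
| word_spanB a b : word_span i a -> word_span i b -> word_span i (a - b)
| word_span_word a s : all (pred2 x y) (a :: s) -> (i <= size s)%N ->
    word_span i (foldl rmul a s).

Lemma word_spanN i a : word_span i a -> word_span i (- a).
Proof.
by move=> ai; rewrite -sub0r; apply: word_spanB => //; apply: word_span0.
Qed.

Lemma word_spanD i a b : word_span i a -> word_span i b -> word_span i (a + b).
Proof. by move=> ai bi; rewrite -[b]opprK; apply/word_spanB/word_spanN. Qed.

Lemma word_spanMn i a n : word_span i a -> word_span i (a *+ n).
Proof.
move=> ai; elim: n => [|n IHn]; first exact: word_span0.
by rewrite mulrS; apply: word_spanD.
Qed.

Lemma word_span_leq i j a : (j <= i)%N -> word_span i a -> word_span j a.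
Proof.
move=> leji; elim=> [|{}a b _ aj _ bj|{}a s xys leis]; first exact: word_span0.
  exact: word_spanB.
by apply: word_span_word => //; apply: leq_trans leis.
Qed.

(** Degree [i] means more than [i] letters, hence the gain of one. *)
Lemma word_spanM i j a b :
  word_span i a -> word_span j b -> word_span (i + j).+1 (a ** b).
Proof.
move=> ai bj; elim: ai => {a} [|a a' _ aP _ a'P|a s /= /andP[xya xys] leis].
- by rewrite rmul0r; apply: word_span0.
- by rewrite rmulDl rmulNr; apply: word_spanB.
elim: bj => {b} [|b b' _ bP _ b'P|b t /= /andP[xyb xyt] lejt].
- by rewrite rmulr0; apply: word_span0.
- by rewrite rmulDr rmulrN; apply: word_spanB.
rewrite -foldl_rmul_cat; apply: word_span_word.
  by rewrite /= all_cat xya xys /= xyb.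
by rewrite size_cat /= addnS ltnS leq_add.
Qed.

Lemma word_span_eq0 K a :
    (forall a s, all (pred2 x y) (a :: s) -> (K <= size s)%N ->
      foldl rmul a s = 0) ->
  word_span K a -> a = 0.
Proof.
by move=> KP; elim=> [//|b c _ -> _ ->|b s /KP]; [rewrite subr0 | apply].
Qed.

Lemma word_spanMl i a b :
  word_span 0 a -> word_span i b -> word_span i.+1 (a ** b).
Proof. exact: word_spanM. Qed.

Lemma word_spanMr i a b :
  word_span i a -> word_span 0 b -> word_span i.+1 (a ** b).
Proof. by rewrite -{2}[i]addn0; apply: word_spanM. Qed.

Lemma word_span_gen a : a \in pred2 x y -> word_span 0 a.
Proof.
by move=> xya; apply: (word_span_word (s := [::])); rewrite //= andbT.
Qed.

Lemma word_span_adj_mul a b :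
  word_span 0 a -> word_span 0 b -> word_span 0 (adj_mul a b).
Proof.
move=> a0 b0; apply: word_spanD; first exact: word_spanD.
exact/(@word_span_leq 1)/word_spanMl.
Qed.

Lemma word_span_adj_inv a : word_span 0 a -> word_span 0 (adj_inv a).
Proof.
move=> a0; apply: (big_ind (word_span 0)); first exact: word_span0.
  by move=> b c; apply: word_spanD.
(* [big_ind] forgets that indices start at 1; at index 0 the default power 0 is in the span. *)
case=> [|i] _; first exact: word_span0.
elim: i => [|i IHi]; first exact: word_spanN.
rewrite rpowS //; apply/(@word_span_leq 1)/word_spanMl => //.
exact: word_spanN.
Qed.

(** By [adj_commgE] the commutator is [d + w ** d], where [d] is the ring commutator of [g] and [h],
    of degree [i + 1]. *)
Lemma word_span_commg i (g h : adjoint R) :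
  word_span i g -> word_span 0 h -> word_span i.+1 ([~ g, h]%g : adjoint R).
Proof.
move=> gi h0; have g0 : word_span 0 g by apply: word_span_leq gi.
rewrite (adj_commgE (esym (commgC g h))).
have di : word_span i.+1 ((g : R) ** h - (h : R) ** g).
  by apply: word_spanB; [apply: word_spanMr | apply: word_spanMl].
apply: word_spanD => //; apply/(@word_span_leq i.+2)/word_spanMl => //.
exact/word_span_adj_inv/word_span_adj_mul.
Qed.

(** In [(1 + g)^n = 1 + n g + ...] the remaining terms have at least two factors [g]. When
    [p R = 0], a [p]-th power thus gains a degree. *)
Lemma word_span_adj_expg i (g : adjoint R) n :
  word_span i g -> word_span i.+1 ((g ^+ n)%g - (g : R) *+ n : R).
Proof.
move=> gi; have g0 : word_span 0 g by apply: word_span_leq gi.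
elim: n => [|n IHn]; first by rewrite mulr0n subr0; apply: word_span0.
pose v : R := (g ^+ n)%g.
have -> : ((g ^+ n.+1)%g : adjoint R) = adj_mul (g : R) v by rewrite expgS.
have vi : word_span i v.
  rewrite -(subrK ((g : R) *+ n) v); apply: word_spanD; last exact: word_spanMn.
  exact: word_span_leq IHn.
have -> : adj_mul (g : R) v - (g : R) *+ n.+1 =
    (v - (g : R) *+ n) + (g : R) ** v.
  rewrite mulrS /adj_mul opprD !addrA.
  by rewrite [LHS](ACl (1*4*2*5*3)%AC) /= subrr add0r.
by apply: word_spanD => //; apply: word_spanMl.
Qed.

End WordSpan.

(** * Properties of the adjoint group required by [WCG] *)

(** Each commutation with [y] gains a degree, and degree [K] is zero. Taking [K + 1] ensures that
    the Engel length is positive. *)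
Lemma adjoint_engel (R : nilRngType) : finitely_many_orbits (@rng_aut R) 3 ->
  exists2 n, (1 <= n)%N & engel (adjoint R) n.
Proof.
move=> /long_words_vanish[K KP]; exists K.+1 => // x y.
have span_i i : word_span (x : R) (y : R) i (iter i (fun z => [~ z, y]%g) x).
  elim: i => [|i IHi]; first by apply: word_span_gen; rewrite !inE eqxx.
  by apply: word_span_commg => //; apply: word_span_gen; rewrite !inE eqxx orbT.
by apply: word_span_eq0 (word_span_leq (leqnSn K) (span_i K.+1)); apply: KP.
Qed.

(** The order [m] of [x] divides [p ^ k], by division with remainder, so it is a power of [p]. *)
Lemma p_group_of_expg (G : groupType) p : prime p ->
  (forall x : G, exists k, x ^+ (p ^ k) = 1)%g -> p_group G p.
Proof.
move=> p_pr Gp x; have [k xk] := Gp x.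
have ex_m : exists m, (0 < m)%N && (x ^+ m == 1)%g.
  by exists (p ^ k)%N; rewrite expn_gt0 prime_gt0 ?xk ?eqxx.
case: (ex_minnP ex_m) => m /andP[m0 /eqP xm] m_min.
have min_m j : (0 < j < m)%N -> (x ^+ j)%g <> 1%g.
  move=> /andP[j0 ltjm] xj; have := m_min j.
  by rewrite j0 xj eqxx leqNgt ltjm => /(_ isT).
have /(dvdn_pfactor _ _ p_pr)[i _ mE] : (m %| p ^ k)%N.
  apply: contraT; rewrite /dvdn -lt0n => r0.
  have /min_m[] : (0 < p ^ k %% m < m)%N by rewrite r0 ltn_mod.
  move: xk; rewrite {1}(divn_eq (p ^ k) m).
  by rewrite expgnDr mulnC expgnA xm expg1n mul1g.
by exists i; rewrite -mE.
Qed.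

(** Each [p]-th power gains a degree in the words in [x] alone, so the power [p ^ K] is trivial. *)
Lemma adjoint_p_group (R : nilRngType) p : prime p ->
    finitely_many_orbits (@rng_aut R) 3 -> (forall a : R, a *+ p = 0) ->
  p_group (adjoint R) p.
Proof.
move=> p_pr /long_words_vanish[K KP] Rp; apply: p_group_of_expg => // x.
exists K.
suff span_i i : word_span (x : R) (x : R) i (x ^+ (p ^ i))%g.
  by apply: word_span_eq0 (span_i K); apply: KP.
elim: i => [|i IHi].
  by rewrite expn0 expg1; apply: word_span_gen; rewrite !inE eqxx.
by have := word_span_adj_expg p IHi; rewrite Rp subr0 expnSr expgnA.
Qed.

(** Ring automorphisms preserve [adj_mul], and enlarging the set of automorphisms only merges
    orbits. *)
Lemma adjoint_omega_categorical (R : nilRngType) :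
  omega_categorical (@rng_aut R) -> omega_categorical (@group_aut (adjoint R)).
Proof.
move=> [cR orb]; split=> // n; move: (orb n).
apply: (finitely_many_orbits_transfer (h := fun x : adjoint R => x : R)).
- exact: rng_aut_id.
- move=> f g [bf fM] [bg gM]; split; first exact: bij_comp.
  by move=> x y /=; rewrite gM fM.
move=> f [bf fD fM]; exists f => //; split=> // x y.
rewrite -[LHS]/(f (adj_mul x y)) -[RHS]/(adj_mul (f x) (f y)).
by rewrite /adj_mul !fD fM.
Qed.

(** * Bounded exponent and reduction modulo primes *)

(** Two multiples of [a] with coefficients [i < j <= K] coincide, so [j - i], a divisor of [K!],
    kills [a]. *)
Lemma bounded_exponent (R : nilRngType) : finitely_many_orbits (@rng_aut R) 3 ->
  exists2 N, (0 < N)%N & forall a : R, a *+ N = 0.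
Proof.
move=> /eventually_repeats[K KP]; exists K`! => [|a]; first exact: fact_gt0.
have [f fA fa _ i|i [j [ltij lejK aij]]] := KP a a (fun i => a *+ i).
  by rewrite rng_autMn // fa.
have ji0 : a *+ (j - i) = 0 by rewrite mulrnBr ?(ltnW ltij) // aij subrr.
have /dvdnP[q ->] : (j - i %| K`!)%N.
  by apply: dvdn_fact; rewrite subn_gt0 ltij (leq_trans (leq_subr _ _)).
by rewrite mulnC mulrnA ji0 mul0rn.
Qed.

Section Multiples.
Variables (R : nilRngType) (p : nat).

Definition multiples : {pred R} := fun a => `[< exists b, a = b *+ p >].

Lemma multiplesP a : reflect (exists b, a = b *+ p) (a \in multiples).
Proof. exact: asboolP. Qed.

Lemma rmulMnl (a b : R) n : (a *+ n) ** b = (a ** b) *+ n.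
Proof.
elim: n => [|n IHn]; first by rewrite !mulr0n rmul0r.
by rewrite !mulrS rmulDl IHn.
Qed.

Lemma rmulMnr (a b : R) n : a ** (b *+ n) = (a ** b) *+ n.
Proof.
elim: n => [|n IHn]; first by rewrite !mulr0n rmulr0.
by rewrite !mulrS rmulDr IHn.
Qed.

Lemma multiples_zmod_closed : zmod_closed multiples.
Proof.
split=> [|_ _ /multiplesP[a ->] /multiplesP[b ->]]; apply/multiplesP.
  by exists 0; rewrite mul0rn.
by exists (a - b); rewrite mulrnBl.
Qed.

Lemma multiplesMl a x : x \in multiples -> a ** x \in multiples.
Proof.
move=> /multiplesP[b ->]; apply/multiplesP.
by exists (a ** b); rewrite rmulMnr.
Qed.

Lemma multiplesMr a x : x \in multiples -> x ** a \in multiples.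
Proof.
move=> /multiplesP[b ->]; apply/multiplesP.
by exists (b ** a); rewrite rmulMnl.
Qed.

Definition multiples_ideal :=
  RngIdeal multiples_zmod_closed multiplesMl multiplesMr.

Lemma multiples_aut f : rng_aut f ->
  forall a, a \in multiples_ideal -> f a \in multiples_ideal.
Proof.
move=> fA _ /multiplesP[b ->]; apply/multiplesP.
by exists (f b); rewrite rng_autMn.
Qed.

Lemma quot_multiples (x : rng_quot multiples_ideal) : x *+ p = 0.
Proof.
rewrite -(rng_reprK x); set a := rng_repr x.
have -> n : rng_pi multiples_ideal a *+ n = rng_pi _ (a *+ n).
  by elim: n => [|n IHn]; rewrite ?mulr0n ?rng_pi0 // !mulrS rng_piD IHn.
by apply/rng_pi_eq0/multiplesP; exists a.
Qed.

End Multiples.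

(** [WCG] makes the adjoint group of [R / p R] nilpotent, so this quotient is nilpotent by
    [nilpotent_of_adjoint]. *)
Lemma nilpotent_mod_prime (R : nilRngType) p : Cherlin_theorem_I -> WCG ->
    omega_categorical (@rng_aut R) -> prime p ->
  exists2 k, (0 < k)%N & products_in [set` @multiples R p] k.
Proof.
move=> cherlin wcg wR p_pr; pose Q := rng_quot (multiples_ideal R p).
have wQ : omega_categorical (@rng_aut Q).
  exact: quot_omega_categorical (@multiples_aut R p) wR.
have orbQ := wQ.2 3; have [n n1 engQ] := adjoint_engel orbQ.
have pQ := adjoint_p_group p_pr orbQ (@quot_multiples R p).
have [c c1] :=
  wcg p n (adjoint Q) p_pr n1 (adjoint_omega_categorical wQ) engQ pQ.
apply: (nilpotent_quot (I := multiples_ideal R p)).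
by apply: (@nilpotent_of_adjoint c) => //; rewrite c1.
Qed.

Theorem corollary2p6 :
  Cherlin_theorem_I ->
  (forall (p : nat) (A : nilRngAlgType 'F_p), prime p ->
     omega_categorical (@rng_aut A) -> nilpotent_group (adjoint A) ->
     nilpotent_rng A) /\
  (WCG ->
   forall R : nilRngType, omega_categorical (@rng_aut R) -> nilpotent_rng R).
Proof.
move=> cherlin; split=> [p A _ [_ orb] [n An]|wcg R wR].
  by apply: (@nilpotent_of_adjoint n) => //; rewrite An.
have [N N0 RN] := bounded_exponent (wR.2 3).
suff [k k0 kP] : exists2 k, (0 < k)%N & products_in [set` @multiples R N] k.
  by exists k => // x s sz; have /multiplesP[b ->] := kP x s sz; rewrite RN.
(* [RN] is dropped because the induction passes to [N %/ p], which need not kill [R]. *)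
elim/ltn_ind: N N0 {RN} => N IHN N0.
have [N1|N1] := leqP N 1.
  have -> : N = 1%N by apply/eqP; rewrite eqn_leq N1.
  by exists 1%N => // x s _; apply/multiplesP; exists (foldl rmul x s).
pose p := pdiv N; have p_pr : prime p := pdiv_prime N1.
have NE : N = (p * (N %/ p))%N by rewrite mulnC divnK ?pdiv_dvd.
have [k k0 kP] := nilpotent_mod_prime cherlin wcg wR p_pr.
have [||l l0 lP] := IHN (N %/ p)%N.
- by rewrite ltn_Pdiv ?prime_gt1.
- by rewrite divn_gt0 ?prime_gt0 // dvdn_leq ?pdiv_dvd.
(* The first [k] letters give a multiple of [p], the last [l] a multiple of [N %/ p]. *)
exists (k + l)%N; first by rewrite addn_gt0 k0.
apply: products_inD kP lP _ => // x y /multiplesP[b ->] /multiplesP[c ->].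
by apply/multiplesP; exists (b ** c); rewrite rmulMnl rmulMnr -mulrnA mulnC -NE.
Qed.
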